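(* $\mathsf{DLBWE}$ is $\mathcal H_\beta(@)$-definable if and only if (B8) is relatively $\mathcal H_\beta(@)$-definable with respect to $\mathsf{LBWE}$.
   Context: A 3-frame is $\langle W,B\rangle$, $B\subseteq W^3$; $\#(x,y,z)$ means pairwise distinct. $\mathsf{LBWE}$: 3-frames satisfying (B1) $B(x,y,z)\to\#(x,y,z)$; (B2) $B(x,y,z)\to B(z,y,x)$; (B3) $B(x,y,z)\to\neg B(x,z,y)$; (B4) $B(x,y,z)\wedge B(y,z,u)\to B(x,y,u)$; (B5) $B(x,y,z)\wedge B(y,u,z)\to B(x,y,u)$; (B6) $\#(x,y,z)\to B(x,y,z)\vee B(x,z,y)\vee B(y,x,z)$; (B7) $\forall y\exists x\exists z\,B(x,y,z)$. $\mathsf{DLBWE}$: members of $\mathsf{LBWE}$ satisfying (B8) $x\neq z\to\exists y\,B(x,y,z)$. $\mathcal H_\beta(@)$: $\varphi::=\top\mid p\mid i\mid\neg\varphi\mid\varphi\wedge\psi\mid\langle B\rangle(\varphi,\psi)\mid @_i\varphi$; valuations map variables to subsets, nominals to singletons; $w\Vdash\langle B\rangle(\varphi,\psi)$ iff there are $x,y$ with $x\Vdash\varphi$, $y\Vdash\psi$, $B(x,w,y)$; $w\Vdash i$ iff $V(i)=\{w\}$; $w\Vdash @_i\varphi$ iff the element of $V(i)$ satisfies $\varphi$. A class $K$ is $\mathcal H_\beta(@)$-definable if some set $\Phi$ of formulas satisfies: for every 3-frame $\mathfrak F$, $\mathfrak F\in K$ iff all of $\Phi$ is valid on $\mathfrak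 F$. (B8) is relatively definable w.r.t. $\mathsf{LBWE}$ if some set $\Phi$ satisfies: for every $\mathfrak F\in\mathsf{LBWE}$, $\mathfrak F$ satisfies (B8) iff all of $\Phi$ is valid on $\mathfrak F$. *)

(* Defs.v *)
From mathcomp Require Import all_boot.
From mathcomp Require Import boolp classical_sets.

Set Implicit Arguments.
Unset Strict Implicit.
Unset Printing Implicit Defensive.

Local Open Scope classical_set_scope.

(* The carrier may be empty.  This is harmless: the empty frame has no
   valuation, hence validates every formula, and it satisfies B1-B8, so
   requiring nonempty carriers would change neither notion of definability. *)
Record frame3 : Type := Frame3 {
  world :> Type;
  betw : world -> world -> world -> Prop }.

Definition distinct3 (T : Type) (x y z : T) : Prop :=
  [/\ x <> y, y <> z & x <> z].

Definition B1 (F : frame3) : Prop :=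
  forall x y z : F, betw x y z -> distinct3 x y z.
Definition B2 (F : frame3) : Prop :=
  forall x y z : F, betw x y z -> betw z y x.
Definition B3 (F : frame3) : Prop :=
  forall x y z : F, betw x y z -> ~ betw x z y.
Definition B4 (F : frame3) : Prop :=
  forall x y z u : F, betw x y z -> betw y z u -> betw x y u.
Definition B5 (F : frame3) : Prop :=
  forall x y z u : F, betw x y z -> betw y u z -> betw x y u.
Definition B6 (F : frame3) : Prop :=
  forall x y z : F, distinct3 x y z ->
    [\/ betw x y z, betw x z y | betw y x z].
Definition B7 (F : frame3) : Prop :=
  forall y : F, exists x z : F, betw x y z.
Definition B8 (F : frame3) : Prop :=
  forall x z : F, x <> z -> exists y : F, betw x y z.

Definition LBWE : set frame3 :=
  [set F | [/\ B1 F, B2 F, B3 F & B4 F] /\ [/\ B5 F, B6 F & B7 F]].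

Definition DLBWE : set frame3 := [set F | LBWE F /\ B8 F].

(* Propositional variables and nominals: two disjoint countably infinite
   supplies, each indexed by nat. *)
Inductive form : Type :=
| Top
| Var of nat
| Nom of nat
| Neg of form
| And of form & form
| DiaB of form & form
| At of nat & form.

Record valuation (F : frame3) : Type := Valuation {
  val_var : nat -> set F;
  val_nom : nat -> set F;
  val_nomP : forall i, exists w, val_nom i = [set w] }.

Fixpoint sat (F : frame3) (V : valuation F) (w : F) (phi : form) : Prop :=
  match phi with
  | Top => True
  | Var p => val_var V p w
  | Nom i => val_nom V i = [set w]
  | Neg psi => ~ sat V w psi
  | And psi chi => sat V w psi /\ sat V w chi
  | DiaB psi chi =>
      exists x y, [/\ sat V x psi, sat V y chi & betw x w y]
  | At i psi => exists v, val_nom V i = [set v] /\ sat V v psi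
  end.

Definition valid (F : frame3) (phi : form) : Prop :=
  forall (V : valuation F) (w : F), sat V w phi.

Definition valid_set (F : frame3) (Phi : set form) : Prop :=
  forall phi, Phi phi -> valid F phi.

Definition definable (K : set frame3) : Prop :=
  exists Phi : set form, forall F : frame3, K F <-> valid_set F Phi.

Definition relatively_definable (P : frame3 -> Prop) (K : set frame3) : Prop :=
  exists Phi : set form,
    forall F : frame3, K F -> (P F <-> valid_set F Phi).

(* Main.v *)
From mathcomp Require Import all_boot.
From mathcomp Require Import boolp classical_sets.
Require Import Defs.

Set Implicit Arguments.
Unset Strict Implicit.
Unset Printing Implicit Defensive.

Local Open Scope classical_set_scope.

(** (B1)-(B6) are universal conditions, so each is expressed by a formula
    whose only atoms are nominals, the nominals playing the role of the
    quantified points; (B7) is the validity of [<B>(T, T)].  Hence LBWE is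
    definable outright, and adding its defining formula to a set that
    defines (B8) relative to LBWE defines DLBWE. *)

Lemma singleton_inj (T : Type) (x y : T) : [set x] = [set y] -> x = y.
Proof. by move=> xy; have : [set y] x by rewrite -xy. Qed.

Definition Imp (phi psi : form) : form := Neg (And phi (Neg psi)).
Definition Or (phi psi : form) : form := Neg (And (Neg phi) (Neg psi)).
Definition EqF (i j : nat) : form := At i (Nom j).
(** The diamond speaks about the middle point of a triple, so [At] jumps to [j] and the two end
    points become its arguments. *)
Definition BetwF (i j k : nat) : form := At j (DiaB (Nom i) (Nom k)).
Definition DistinctF (i j k : nat) : form :=
  And (Neg (EqF i j)) (And (Neg (EqF j k)) (Neg (EqF i k))).

Definition names (F : frame3) (V : valuation F) (s : nat -> F) : Prop :=
  forall i, val_nom V i = [set s i].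

Lemma names_exists (F : frame3) (V : valuation F) : exists s, names V s.
Proof. by have [s Vs] := boolp.choice (val_nomP V); exists s. Qed.

(** Realizes an arbitrary assignment of points as a valuation. The variables get the empty set, an
    arbitrary choice, since the formulas evaluated under it contain none. *)
Definition nom_valuation (F : frame3) (s : nat -> F) : valuation F :=
  Valuation (fun=> set0) (fun i => ex_intro _ (s i) (erefl [set s i])).

Lemma nom_valuation_names (F : frame3) (s : nat -> F) :
  names (nom_valuation s) s.
Proof. by []. Qed.

(** The encoding through negation and conjunction gives back the implication by double negation
    elimination. *)
Lemma sat_Imp (F : frame3) (V : valuation F) w phi psi :
  sat V w (Imp phi psi) = (sat V w phi -> sat V w psi).
Proof.
apply/propext; split=> /= [h hphi | h [/h]//].
by apply: contrapT => hpsi; apply: h.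
Qed.

Lemma sat_Or (F : frame3) (V : valuation F) w phi psi :
  sat V w (Or phi psi) = (sat V w phi \/ sat V w psi).
Proof.
apply/propext; split=> /= [h | [h|h] []//].
by apply: contrapT => /not_orP.
Qed.

Section Named.
Context (F : frame3) (V : valuation F) (s : nat -> F) (Vs : names V s).

Lemma sat_Nom w i : sat V w (Nom i) = (s i = w).
Proof.
rewrite /= Vs; apply/propext; split=> [e | ->] //.
exact: singleton_inj e.
Qed.

Lemma sat_At w i phi : sat V w (At i phi) = sat V (s i) phi.
Proof.
apply/propext; rewrite /= Vs; split=> [[v [sv]] | h].
  by rewrite (singleton_inj sv).
by exists (s i).
Qed.

Lemma sat_EqF w i j : sat V w (EqF i j) = (s i = s j).
Proof. by rewrite sat_At sat_Nom; apply/propext; split. Qed.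

Lemma sat_BetwF w i j k : sat V w (BetwF i j k) = betw (s i) (s j) (s k).
Proof.
rewrite sat_At; apply/propext; split=> [[x [y []]] | h].
  by rewrite -/(sat V x (Nom i)) -/(sat V y (Nom k)) !sat_Nom => -> ->.
by exists (s i), (s k); split; rewrite ?sat_Nom.
Qed.

Lemma sat_DistinctF w i j k :
  sat V w (DistinctF i j k) = distinct3 (s i) (s j) (s k).
Proof.
have -> : sat V w (DistinctF i j k) =
    (~ sat V w (EqF i j) /\ ~ sat V w (EqF j k) /\ ~ sat V w (EqF i k)) by [].
by rewrite !sat_EqF; apply/propext; split=> [[? []]|[]].
Qed.

Definition sat_named :=
  (sat_Imp, sat_Or, sat_EqF, sat_BetwF, sat_DistinctF).

End Named.

(** Every valuation names some assignment [s] and every [s] is named by some valuation. As [P] sees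
    neither the world nor the variables, quantifying over valuations and worlds amounts to
    quantifying over assignments. *)
Lemma valid_pure (F : frame3) (phi : form) (P : (nat -> F) -> Prop) :
    (forall V s w, names V s -> sat V w phi = P s) ->
  valid F phi <-> forall s, P s.
Proof.
move=> phiP; split=> [h s | h V w].
  (* Validity has to be used at some world; [s 0] is one at hand, and any other would give the same
     [P s]. *)
  by rewrite -(phiP _ s (s 0) (nom_valuation_names s)).
by have [s Vs] := names_exists V; rewrite (phiP _ s).
Qed.

Lemma valid_And (F : frame3) (phi psi : form) :
  valid F (And phi psi) <-> valid F phi /\ valid F psi.
Proof.
split=> [h | [h1 h2] V w]; last by split; [apply: h1 | apply: h2].
by split=> V w; have [] := h V w.
Qed.

Definition B1F : form := Imp (BetwF 0 1 2) (DistinctF 0 1 2).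
Definition B2F : form := Imp (BetwF 0 1 2) (BetwF 2 1 0).
Definition B3F : form := Imp (BetwF 0 1 2) (Imp (BetwF 0 2 1) (Neg Top)).
Definition B4F : form :=
  Imp (BetwF 0 1 2) (Imp (BetwF 1 2 3) (BetwF 0 1 3)).
Definition B5F : form :=
  Imp (BetwF 0 1 2) (Imp (BetwF 1 3 2) (BetwF 0 1 3)).
Definition B6F : form :=
  Imp (DistinctF 0 1 2) (Or (BetwF 0 1 2) (Or (BetwF 0 2 1) (BetwF 1 0 2))).
Definition B7F : form := DiaB Top Top.

Lemma valid_B1F (F : frame3) : valid F B1F <-> B1 F.
Proof.
rewrite (valid_pure (P := fun s => betw (s 0) (s 1) (s 2) ->
  distinct3 (s 0) (s 1) (s 2))); last by move=> V s w Vs; rewrite !(sat_named Vs).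
split=> [h x y z | h s]; last exact: h.
(* The assignment sends 0, 1, 2 to [x], [y], [z]; the default [x] at larger indices is harmless, as
   these nominals do not occur. *)
exact: (h (nth x [:: x; y; z])).
Qed.

Lemma valid_B2F (F : frame3) : valid F B2F <-> B2 F.
Proof.
rewrite (valid_pure (P := fun s => betw (s 0) (s 1) (s 2) ->
  betw (s 2) (s 1) (s 0))); last by move=> V s w Vs; rewrite !(sat_named Vs).
split=> [h x y z | h s]; last exact: h.
exact: (h (nth x [:: x; y; z])).
Qed.

Lemma valid_B3F (F : frame3) : valid F B3F <-> B3 F.
Proof.
rewrite (valid_pure (P := fun s => betw (s 0) (s 1) (s 2) ->
  betw (s 0) (s 2) (s 1) -> ~ True)); last first.
  by move=> V s w Vs; rewrite !(sat_named Vs).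
split=> [h x y z b b' | h s b /(h _ _ _ b)//].
exact: (h (nth x [:: x; y; z]) b b').
Qed.

Lemma valid_B4F (F : frame3) : valid F B4F <-> B4 F.
Proof.
rewrite (valid_pure (P := fun s => betw (s 0) (s 1) (s 2) ->
  betw (s 1) (s 2) (s 3) -> betw (s 0) (s 1) (s 3))); last first.
  by move=> V s w Vs; rewrite !(sat_named Vs).
split=> [h x y z u | h s]; last exact: h.
exact: (h (nth x [:: x; y; z; u])).
Qed.

Lemma valid_B5F (F : frame3) : valid F B5F <-> B5 F.
Proof.
rewrite (valid_pure (P := fun s => betw (s 0) (s 1) (s 2) ->
  betw (s 1) (s 3) (s 2) -> betw (s 0) (s 1) (s 3))); last first.
  by move=> V s w Vs; rewrite !(sat_named Vs).
split=> [h x y z u | h s]; last exact: h.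
exact: (h (nth x [:: x; y; z; u])).
Qed.

Lemma valid_B6F (F : frame3) : valid F B6F <-> B6 F.
Proof.
rewrite (valid_pure (P := fun s => distinct3 (s 0) (s 1) (s 2) ->
  betw (s 0) (s 1) (s 2) \/
  (betw (s 0) (s 2) (s 1) \/ betw (s 1) (s 0) (s 2)))); last first.
  by move=> V s w Vs; rewrite !(sat_named Vs).
split=> [h x y z d | h s /h]; last by case; tauto.
by have /= [|[]] := h (nth x [:: x; y; z]) d;
  [constructor 1 | constructor 2 | constructor 3].
Qed.

Lemma valid_B7F (F : frame3) : valid F B7F <-> B7 F.
Proof.
split=> [h y | h V w].
  by have [x [z [_ _ b]]] := h (nom_valuation (fun=> y)) y; exists x, z.
by have [x [z b]] := h w; exists x, z.
Qed.

Definition LBWEF : form :=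
  And B1F (And B2F (And B3F (And B4F (And B5F (And B6F B7F))))).

Lemma valid_LBWEF (F : frame3) : valid F LBWEF <-> LBWE F.
Proof.
rewrite !valid_And valid_B1F valid_B2F valid_B3F valid_B4F valid_B5F valid_B6F.
rewrite valid_B7F; split=> [[? [? [? [? [? [? ?]]]]]] | ].
  by split; split.
by case=> -[? ? ? ?] [? ? ?].
Qed.

Theorem theorem5p1 : definable DLBWE <-> relatively_definable B8 LBWE.
Proof.
split=> [[Phi PhiP] | [Phi PhiP]].
  (* The same set works: inside [LBWE], belonging to [DLBWE] is just (B8). *)
  exists Phi => F FL; rewrite -PhiP.
  by split=> [|[]].
exists (Phi `|` [set LBWEF]) => F; split=> [[FL F8] phi [|->] | h].
- by move: phi; apply/(PhiP F FL).
- exact/valid_LBWEF.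
(* Outside [LBWE] nothing is known about [Phi], so membership must first be read off from [LBWEF];
   only then does [Phi] yield (B8). *)
have FL : LBWE F by apply/valid_LBWEF/h; right.
by split=> //; apply/(PhiP F FL) => phi Phiphi; apply: h; left.
Qed.
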